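(* Suppose that $\Lambda$ is a split (basic) finite dimensional algebra over a field $K$ with Jacobson radical $J$, and $\mathfrak{A}$ a full subcategory of $\Lambda\text{-mod}$. Moreover, let $e_1,\dots,e_m$ be pairwise orthogonal primitive idempotents of $\Lambda$, and let $p_1,\dots,p_m,q_1,\dots,q_m\in J$ with $p_i=p_ie_i$ and $q_i=q_ie_i$ for all $i$. For each positive integer $i$, let $r(i)\in\{1,\dots,m\}$ be the element congruent to $i$ modulo $m$. Suppose the following conditions are satisfied: (1) For each $n\in\mathbb{N}$ (i.e. $n\geq 1$), there is a module $M_n\in\mathfrak{A}$, together with a sequence $x_{n1},\dots,x_{n,mn}$ of $mn$ top elements of $M_n$ which are $K$-linearly independent modulo $JM_n$, such that $$0\neq p_{r(i)}x_{ni}=q_{r(i+1)}x_{n,i+1}\quad\text{for } 1\le i<mn.$$ (2) For any object $C$ in $\mathfrak{A}$, the following are true: (i) if $x\in C$ is a top element of type $e_1$, then $p_1x\neq0$; (ii) for every positive integer $i$: if $y,z\in C$ with $0\neq p_{r(i)}y=q_{r(i+1)}z$, then $p_{r(i+1)}z\neq0$. Then $S_1=\Lambda e_1/Je_1$ does not have an $\{M_n\mid n\in\mathbb{N}\}$-approximation inside $\mathfrak{A}$. In particular, $\mathfrak{A}$ is not contravariantly finite in $\Lambda\text{-mod}$ in that case.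
   Context: $\Lambda\text{-mod}$ is the category of finitely generated left $\Lambda$-modules. ''Split'' means that $\Lambda$ is of the form $K\Gamma/I$ with $\Gamma$ a quiver and $I$ an admissible ideal of the path algebra $K\Gamma$ (so $\Lambda$ is basic and all its simple modules are one-dimensional over $K$). A complete set of pairwise orthogonal primitive idempotents of $\Lambda$ containing $e_1,\dots,e_m$ is fixed. For a left $\Lambda$-module $M$, an element $x\in M$ is a top element of $M$ if $x\in M\setminus JM$ and $ex=x$ for some idempotent $e$ in this fixed set; in that case $x$ is called a top element of type $e$. For a class $\mathfrak{C}$ of objects of $\mathfrak{A}$ and $X\in\Lambda\text{-mod}$, a $\mathfrak{C}$-approximation of $X$ inside $\mathfrak{A}$ is a homomorphism $f:A\to X$ with $A\in\mathfrak{A}$ such that each homomorphism $C\to X$ with $C\in\mathfrak{C}$ factors through $f$. An $\mathfrak{A}$-approximation of $X$ is the case $\mathfrak{C}=\mathfrak{A}$. The subcategory $\mathfrak{A}$ is contravariantly finite in $\Lambda\text{-mod}$ if every object of $\Lambda\text{-mod}$ has an $\mathfrak{A}$-approximation. *)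

(* Defs.v *)
From HB Require Import structures.
From mathcomp Require Import all_boot all_order all_algebra all_field.
From mathcomp Require Import generic_quotient ring_quotient.
From mathcomp Require Import finmap.
From mathcomp Require Import boolp.
From mathcomp.multinomials Require Import monalg.

Set Implicit Arguments.
Unset Strict Implicit.
Unset Printing Implicit Defensive.

Import GRing.Theory.
Local Open Scope ring_scope.
Local Open Scope quotient_scope.

Section Ideals.
Variable R : pzRingType.
Implicit Types (I S : R -> Prop) (a x y : R).

Definition left_ideal I : Prop :=
  [/\ I 0, forall x y, I x -> I y -> I (x + y) & forall a x, I x -> I (a * x)].

Definition two_sided_ideal I : Prop :=
  left_ideal I /\ forall a x, I x -> I (x * a).

Definition generated_ideal S : R -> Prop := fun x =>
  forall I, two_sided_ideal I -> (forall y, S y -> I y) -> I x.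

Definition ideal_product I1 I2 : R -> Prop :=
  generated_ideal (fun z => exists x y, [/\ I1 x, I2 y & z = x * y]).

Fixpoint ideal_power I (n : nat) : R -> Prop :=
  if n is n'.+1 then ideal_product I (ideal_power I n') else fun=> True.

Definition maximal_left_ideal I : Prop :=
  [/\ left_ideal I, ~ I 1 &
      forall I', left_ideal I' -> ~ I' 1 -> (forall x, I x -> I' x) ->
        forall x, I' x -> I x].

Definition jacobson_radical : R -> Prop := fun x =>
  forall I, maximal_left_ideal I -> I x.

Definition idempotent_elt a : Prop := a * a = a.

Definition primitive_idempotent a : Prop :=
  [/\ idempotent_elt a, a != 0 &
      forall f g, idempotent_elt f -> idempotent_elt g -> f * g = 0 -> g * f = 0 ->
        a = f + g -> f = 0 \/ g = 0].

End Ideals.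

Definition complete_primitive_idempotents (R : nzRingType) (E : seq R) : Prop :=
  [/\ uniq E, forall a, a \in E -> primitive_idempotent a,
      forall a b, a \in E -> b \in E -> a != b -> a * b = 0
    & \sum_(a <- E) a = 1].

(* Only finite quivers occur, since K Gamma / I is to be a finite dimensional
   algebra with 1; there is at least one vertex, so that K Gamma is nonzero. *)
Record quiver := Quiver {
  vertex : finType;
  arrow : finType;
  source : arrow -> vertex;
  target : arrow -> vertex;
  quiver_nonempty : (0 < #|vertex|)%N }.

Section PathAlgebra.
Variable G : quiver.

Fixpoint composable (v : vertex G) (s : seq (arrow G)) : bool :=
  if s is a :: s' then (source a == v) && composable (target a) s' else true.

(* The path (v, [:: a1; ...; al]) starts at v and runs through a1 first; the
   trivial path at v is (v, [::]). *)
Record qpath := QPath {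
  qpath_val : vertex G * seq (arrow G);
  _ : composable qpath_val.1 qpath_val.2 }.
HB.instance Definition _ := [isSub for qpath_val].
HB.instance Definition _ := [Choice of qpath by <:].

Definition path_source (p : qpath) : vertex G := (val p).1.
Definition path_arrows (p : qpath) : seq (arrow G) := (val p).2.
Definition path_target (p : qpath) : vertex G :=
  last (path_source p) (map (@target G) (path_arrows p)).

Definition trivial_path (v : vertex G) : qpath :=
  @QPath (v, [::]) isT.

Lemma arrow_path_subproof (a : arrow G) : composable (source a) [:: a].
Proof. by rewrite /= eqxx. Qed.

Definition arrow_path (a : arrow G) : qpath :=
  @QPath (source a, [:: a]) (arrow_path_subproof a).

Lemma composable_cat v s t :
  composable v (s ++ t) =
    composable v s && composable (last v (map (@target G) s)) t.
Proof. by elim: s v => //= a s IH v; rewrite IH andbA. Qed.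

(* Paths are composed like maps: q p is "q after p". *)
Definition path_comp (q p : qpath) : option qpath :=
  if path_target p == path_source q
  then insub (path_source p, path_arrows p ++ path_arrows q) else None.

Variant path_comp_spec (q p : qpath) : option qpath -> Type :=
| PathComp r of path_target p = path_source q & path_source r = path_source p
    & path_target r = path_target q
    & path_arrows r = path_arrows p ++ path_arrows q :
    path_comp_spec q p (Some r)
| PathNoComp of path_target p <> path_source q : path_comp_spec q p None.

Lemma path_compP q p : path_comp_spec q p (path_comp q p).
Proof.
rewrite /path_comp; case: eqP => [e|ne]; last exact: PathNoComp.
case: insubP => [r _ vr|].
  apply: PathComp => //; rewrite /path_source /path_arrows ?vr //.
  rewrite /path_target /path_source /path_arrows vr /= map_cat last_cat.
  by rewrite -/(path_source p) -/(path_arrows p) -/(path_target p) e.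
rewrite composable_cat -/(path_target p) e.
by rewrite (valP p) (valP q).
Qed.

Lemma qpath_eq (p q : qpath) :
  path_source p = path_source q -> path_arrows p = path_arrows q -> p = q.
Proof.
move=> e1 e2; apply/val_inj; move: e1 e2; rewrite /path_source /path_arrows.
by case: (val p) (val q) => [? ?] [? ?] /= -> ->.
Qed.

Lemma path_compA q p r :
  obind (fun u => path_comp u r) (path_comp q p) =
  obind (fun u => path_comp q u) (path_comp p r).
Proof.
case: (path_compP q p) => [u e1 su tu au|ne1] /=;
  case: (path_compP p r) => [w e2 sw tw aw|ne2] //=.
- case: (path_compP u r) => [x1 f1 s1 t1 a1|[]]; last by rewrite e2 su.
  case: (path_compP q w) => [x2 f2 s2 t2 a2|[]]; last by rewrite tw.
  by congr Some; apply: qpath_eq; rewrite ?s1 ?s2 ?a1 ?a2 ?au ?aw ?catA ?sw.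
- by case: (path_compP u r) => // x1; rewrite su.
- by case: (path_compP q w) => // x2; rewrite tw.
Qed.

Lemma path_comp1p v p :
  path_comp (trivial_path v) p = if path_target p == v then Some p else None.
Proof.
case: path_compP => [r|/eqP/negPf ->] //=.
rewrite {1}/path_source /= => -> sr _ ar; rewrite eqxx; congr Some.
by apply: qpath_eq; rewrite // ar cats0.
Qed.

Lemma path_compp1 v p :
  path_comp p (trivial_path v) = if path_source p == v then Some p else None.
Proof.
case: path_compP => [r|/eqP/negPf]; rewrite /path_target /= {1}/path_source /=.
  move=> e sr _ ar; rewrite -e eqxx; congr Some.
  by apply: qpath_eq; rewrite // sr -e.
by rewrite eq_sym => ->.
Qed.

Variable K : fieldType.

Definition path_algebra := {malg K[qpath]}.
HB.instance Definition _ := GRing.Lmodule.on path_algebra.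

Definition path_basis (p : qpath) : path_algebra := << p >>.

Definition opath_basis (o : option qpath) : path_algebra :=
  if o is Some p then path_basis p else 0.

Definition path_extend (V : lmodType K) (F : qpath -> V) (f : path_algebra) : V :=
  \sum_(p <- msupp f) f@_p *: F p.

Definition path_mul (f g : path_algebra) : path_algebra :=
  \sum_(q <- msupp f) \sum_(p <- msupp g)
    (f@_q * g@_p) *: opath_basis (path_comp q p).

Definition path_one : path_algebra := \sum_v path_basis (trivial_path v).

Section Extend.
Variables (V : lmodType K) (F : qpath -> V).

Lemma path_extendEw f (D : {fset qpath}) : (msupp f `<=` D)%fset ->
  path_extend F f = \sum_(p <- D) f@_p *: F p.
Proof.
move=> sD; rewrite /path_extend (big_fset_incl _ sD) // => p _ /mcoeff_outdom ->.
by rewrite scale0r.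
Qed.

Lemma path_extend_linear : linear (path_extend F).
Proof.
move=> a f g; pose D := (msupp f `|` msupp g)%fset.
have sf : (msupp f `<=` D)%fset by apply: fsubsetUl.
have sg : (msupp g `<=` D)%fset by apply: fsubsetUr.
have sa : (msupp (a *: f + g) `<=` D)%fset.
  apply/fsubsetP => k; apply: contraLR; rewrite in_fsetU negb_or => /andP[kf kg].
  by rewrite -mcoeff_eq0 mcoeffD mcoeffZ !mcoeff_outdom // mulr0 addr0.
rewrite !(path_extendEw (D := D)) // scaler_sumr -big_split /=.
by apply: eq_bigr => p _; rewrite mcoeffD mcoeffZ scalerDl scalerA.
Qed.

HB.instance Definition _ :=
  GRing.isLinear.Build K path_algebra V *:%R (path_extend F) path_extend_linear.

Lemma path_extendU p : path_extend F (path_basis p) = F p.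
Proof.
by rewrite (path_extendEw (D := [fset p]%fset)) ?msuppU_le // big_seq_fset1
   mcoeffUU scale1r.
Qed.
End Extend.

Lemma path_basis_sum f : f = \sum_(p <- msupp f) f@_p *: path_basis p.
Proof.
apply/malgP => k; rewrite {1}[f]monalgE !raddf_sum /=.
by apply: eq_bigr => p _; rewrite mcoeffZ !mcoeffU mulrnAr mulr1.
Qed.

Lemma path_linear_ext (V : lmodType K) (L1 L2 : {linear path_algebra -> V}) :
  (forall p, L1 (path_basis p) = L2 (path_basis p)) -> L1 =1 L2.
Proof.
move=> e f; rewrite [f]path_basis_sum !linear_sum.
by apply: eq_bigr => p _; rewrite !linearZ e.
Qed.

Lemma path_mulE f g :
  path_mul f g =
  path_extend (fun q => path_extend (fun p => opath_basis (path_comp q p)) g) f.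
Proof.
by apply: eq_bigr => q _; rewrite scaler_sumr; apply: eq_bigr => p _; rewrite scalerA.
Qed.

Definition path_rmul (g f : path_algebra) : path_algebra := path_mul f g.

Lemma path_mul_linearl g : linear (path_rmul g).
Proof. rewrite /path_rmul; by move=> a f1 f2; rewrite !path_mulE linearP. Qed.

Lemma path_mul_linearr f : linear (path_mul f).
Proof.
move=> a g1 g2; rewrite !path_mulE /path_extend scaler_sumr -big_split /=.
apply: eq_bigr => q _; rewrite -!/(path_extend _ _) linearP.
by rewrite scalerDr !scalerA mulrC.
Qed.

HB.instance Definition _ g :=
  GRing.isLinear.Build K path_algebra path_algebra *:%R (path_rmul g)
    (path_mul_linearl g).
HB.instance Definition _ f :=
  GRing.isLinear.Build K path_algebra path_algebra *:%R (path_mul f)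
    (path_mul_linearr f).

Lemma path_mulU q p :
  path_mul (path_basis q) (path_basis p) = opath_basis (path_comp q p).
Proof. by rewrite path_mulE !path_extendU. Qed.

Lemma path_mulA : associative path_mul.
Proof.
move=> f g h.
pose L1 g h : {linear path_algebra -> path_algebra} :=
  path_rmul (path_mul g h).
pose L2 g h : {linear path_algebra -> path_algebra} :=
  path_rmul h \o path_rmul g.
apply: (@path_linear_ext _ (L1 g h) (L2 g h)) => q /=.
pose L3 h : {linear path_algebra -> path_algebra} :=
  path_mul (path_basis q) \o path_rmul h.
pose L4 h : {linear path_algebra -> path_algebra} :=
  path_rmul h \o path_mul (path_basis q).
apply: (@path_linear_ext _ (L3 h) (L4 h)) => p /=.
pose L5 : {linear path_algebra -> path_algebra} :=
  path_mul (path_basis q) \o path_mul (path_basis p).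
pose L6 : {linear path_algebra -> path_algebra} :=
  path_mul (path_mul (path_basis q) (path_basis p)).
apply: (@path_linear_ext _ L5 L6) => r /=.
rewrite /path_rmul !path_mulU; have := path_compA q p r.
case: (path_comp q p) => [u|]; case: (path_comp p r) => [w|] //=.
- by rewrite !path_mulU => ->.
- by rewrite path_mulU => ->; rewrite linear0.
- by rewrite path_mulU => <-; rewrite -[path_mul 0 _]/(path_rmul _ 0) linear0.
- by rewrite -[path_mul 0 _]/(path_rmul _ 0) !linear0.
Qed.

Lemma path_mul1 : left_id path_one path_mul.
Proof.
move=> f; pose L1 : {linear path_algebra -> path_algebra} := path_mul path_one.
apply: (@path_linear_ext _ L1 idfun) => p /=; rewrite /L1 /path_rmul /=.
rewrite /path_one -[LHS]/(path_rmul _ _) linear_sum /=.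
rewrite /path_rmul (bigD1 (path_target p)) //= path_mulU path_comp1p eqxx big1 ?addr0 //.
by move=> v; rewrite path_mulU path_comp1p eq_sym => /negPf ->.
Qed.

Lemma path_mulr1 : right_id path_one path_mul.
Proof.
move=> f; pose L1 : {linear path_algebra -> path_algebra} := path_rmul path_one.
apply: (@path_linear_ext _ L1 idfun) => p /=; rewrite /L1 /path_rmul /=.
rewrite /path_one linear_sum /=.
rewrite /path_rmul (bigD1 (path_source p)) //= path_mulU path_compp1 eqxx big1 ?addr0 //.
by move=> v; rewrite path_mulU path_compp1 eq_sym => /negPf ->.
Qed.

Lemma path_mulDl : left_distributive path_mul +%R.
Proof. by move=> f g h; rewrite -![path_mul _ h]/(path_rmul h _) linearD. Qed.

Lemma path_mulDr : right_distributive path_mul +%R.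
Proof. by move=> f g h; rewrite linearD. Qed.

Lemma path_one_neq0 : path_one != 0.
Proof.
have /card_gt0P[v _] := quiver_nonempty G.
apply/eqP => /(congr1 (mcoeff (trivial_path v))).
rewrite mcoeff0 raddf_sum /= (bigD1 v) //= mcoeffUU big1 ?addr0.
  by move/eqP; rewrite oner_eq0.
move=> w; rewrite mcoeffU -val_eqE /= xpair_eqE eqxx andbT => /negPf ->.
by rewrite mulr0n.
Qed.

HB.instance Definition _ :=
  GRing.Zmodule_isNzRing.Build path_algebra
    path_mulA path_mul1 path_mulr1 path_mulDl path_mulDr path_one_neq0.

Lemma path_scaleAl (a : K) (f g : path_algebra) : a *: (f * g) = a *: f * g.
Proof. by rewrite -[RHS]/(path_rmul g _) linearZ. Qed.

HB.instance Definition _ :=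
  GRing.Lmodule_isLalgebra.Build K path_algebra path_scaleAl.

Lemma path_scaleAr (a : K) (f g : path_algebra) : a *: (f * g) = f * (a *: g).
Proof. by rewrite -[RHS]/(path_mul f _) linearZ. Qed.

HB.instance Definition _ :=
  GRing.Lalgebra_isAlgebra.Build K path_algebra path_scaleAr.

Definition arrow_ideal : path_algebra -> Prop :=
  generated_ideal (fun f => exists a, f = path_basis (arrow_path a)).

Definition admissible_ideal (I : path_algebra -> Prop) : Prop :=
  two_sided_ideal I /\
  exists2 n : nat, (2 <= n)%N &
    (forall f, ideal_power arrow_ideal n f -> I f) /\
    (forall f, I f -> ideal_power arrow_ideal 2 f).

End PathAlgebra.

(* Lam is isomorphic to K Gamma / I, given through the projection from K Gamma. *)
Definition split_algebra (K : fieldType) (Lam : falgType K) : Prop :=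
  exists (G : quiver) (I : path_algebra G K -> Prop)
         (phi : {lrmorphism path_algebra G K -> Lam}),
    [/\ admissible_ideal I, forall x, exists f, phi f = x
      & forall f, phi f = 0 <-> I f].

Section LmodQuotient.
Variables (R : nzRingType) (V : lmodType R) (S : {pred V}).
Variable (S_closed : submod_closed S).

Definition submod_pred of submod_closed S : pred V := fun x => x \in S.
Local Notation N := (submod_pred S_closed).
HB.instance Definition _ := GRing.isSubmodClosed.Build R V N S_closed.

Definition lmod_quot := Quotient.quot (GRing.ZmodClosed.clone V N _).
HB.instance Definition _ := GRing.Zmodule.on lmod_quot.
HB.instance Definition _ := EqQuotient.on lmod_quot.

Definition lmod_quot_scale (a : R) (x : lmod_quot) : lmod_quot :=
  \pi_lmod_quot (a *: repr x).

Lemma lmod_quot_eq (x y : V) :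
  (\pi_lmod_quot x = \pi_lmod_quot y) <-> (x - y \in N).
Proof.
by split=> [e|h]; [rewrite Quotient.idealrBE; apply/eqP|
                   apply/eqP; rewrite -Quotient.idealrBE].
Qed.

Lemma lmod_quot_scale_pi (a : R) (x : V) :
  lmod_quot_scale a (\pi_lmod_quot x) = \pi_lmod_quot (a *: x).
Proof.
apply/lmod_quot_eq; rewrite -scalerBr rpredZ //.
by apply/lmod_quot_eq; rewrite reprK.
Qed.

Lemma lmod_quot_piD (x y : V) :
  \pi_lmod_quot (x + y) = \pi_lmod_quot x + \pi_lmod_quot y.
Proof. exact: (raddfD \pi_(Quotient.quot (GRing.ZmodClosed.clone V N _))). Qed.

Fact lmod_quot_scaleA a b x :
  lmod_quot_scale a (lmod_quot_scale b x) = lmod_quot_scale (a * b) x.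
Proof. by rewrite -[x]reprK !lmod_quot_scale_pi scalerA !reprK. Qed.
Fact lmod_quot_scale1 : left_id 1 lmod_quot_scale.
Proof. by move=> x; rewrite -[x]reprK lmod_quot_scale_pi scale1r. Qed.
Fact lmod_quot_scaleDr : right_distributive lmod_quot_scale +%R.
Proof.
move=> a x y; rewrite -[x]reprK -[y]reprK.
by rewrite -lmod_quot_piD !lmod_quot_scale_pi scalerDr lmod_quot_piD.
Qed.
Fact lmod_quot_scaleDl x : {morph lmod_quot_scale^~ x : a b / a + b}.
Proof.
move=> a b; rewrite -[x]reprK.
by rewrite !lmod_quot_scale_pi scalerDl lmod_quot_piD.
Qed.

HB.instance Definition _ := GRing.Zmodule_isLmodule.Build R lmod_quot
  lmod_quot_scaleA lmod_quot_scale1 lmod_quot_scaleDr lmod_quot_scaleDl.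

End LmodQuotient.

(* proj_module e is R e, and top_module e is R e / J e. *)
Section TopModule.
Variables (R : nzRingType) (e : R).

Definition left_span : {pred R^o} := [pred x : R^o | `[< exists a : R, x = a * e >]].

Lemma left_span_closed : submod_closed left_span.
Proof.
split; first by apply/asboolP; exists 0; rewrite mul0r.
move=> a x y /asboolP[b ->] /asboolP[c ->]; apply/asboolP; exists (a * b + c).
by rewrite mulrDl -mulrA.
Qed.
HB.instance Definition _ :=
  GRing.isSubmodClosed.Build R R^o left_span left_span_closed.

Definition proj_module := {x : R^o | x \in left_span}.
HB.instance Definition _ := SubChoice.on proj_module.
HB.instance Definition _ := [SubChoice_isSubLmodule of proj_module by <:].

Definition rad_span : {pred proj_module} :=
  [pred x : proj_module | `[< exists2 j : R, jacobson_radical j & val x = j * e >]].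

Lemma rad_span_closed : submod_closed rad_span.
Proof.
split; first by apply/asboolP; exists 0; rewrite ?mul0r // => I [[]].
move=> a x y /asboolP[b jb eb] /asboolP[c jc ec]; apply/asboolP; exists (a * b + c).
  move=> I mI; case: (mI) => -[_ hD hM] _ _.
  by apply: hD; [apply: hM; apply: jb | apply: jc].
by rewrite [val _](_ : _ = a * val x + val y) // eb ec mulrDl -mulrA.
Qed.

Definition top_module : lmodType R := lmod_quot rad_span_closed.
End TopModule.

Section Modules.
Variable R : nzRingType.

Definition module_class := lmodType R -> Prop.

Definition finitely_generated (M : lmodType R) : Prop :=
  exists (n : nat) (g : 'I_n -> M),
    forall x, exists c : 'I_n -> R, x = \sum_i c i *: g i.

(* A full subcategory is given by its class of objects, which is not required
   to be closed under isomorphism. *)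
Definition full_subcategory_of_fg (A : module_class) : Prop :=
  forall M, A M -> finitely_generated M.

Definition radical_submodule (M : lmodType R) : M -> Prop := fun x =>
  exists (n : nat) (j : 'I_n -> R) (v : 'I_n -> M),
    (forall i, jacobson_radical (j i)) /\ x = \sum_i j i *: v i.

Definition top_element_of_type (E : seq R) (e : R) (M : lmodType R) (x : M) : Prop :=
  [/\ e \in E, ~ radical_submodule x & e *: x = x].

Definition top_element (E : seq R) (M : lmodType R) (x : M) : Prop :=
  exists e, top_element_of_type E e x.

Definition is_approximation (A C : module_class) (X B : lmodType R)
    (f : {linear B -> X}) : Prop :=
  A B /\ forall (D : lmodType R) (g : {linear D -> X}), C D ->
    exists h : {linear D -> B}, forall x, f (h x) = g x.

Definition has_approximation (A C : module_class) (X : lmodType R) : Prop :=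
  exists (B : lmodType R) (f : {linear B -> X}), is_approximation A C f.

Definition contravariantly_finite (A : module_class) : Prop :=
  forall X : lmodType R, finitely_generated X -> has_approximation A A X.

End Modules.

(* K acts on a Lam-module through the scalars c%:A of Lam; the family is
   x 1, ..., x n. *)
Definition independent_mod_radical (K : fieldType) (Lam : falgType K)
    (M : lmodType Lam) (n : nat) (x : nat -> M) : Prop :=
  forall c : nat -> K,
    radical_submodule (\sum_(1 <= i < n.+1) (c i)%:A *: x i : M) ->
    forall i, (1 <= i <= n)%N -> c i = 0.

(* The element of {1, ..., m} congruent to i modulo m, for i, m >= 1. *)
Definition residue (m i : nat) : nat := (i.-1 %% m).+1.

(* Main.v *)
Require Import Defs.
From mathcomp Require Import all_boot all_order all_algebra all_field.
From HB Require Import structures.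
From mathcomp Require Import boolp classical_sets finmap.
From mathcomp.multinomials Require Import monalg.

Set Implicit Arguments.
Unset Strict Implicit.
Unset Printing Implicit Defensive.

Import GRing.Theory.
Local Open Scope ring_scope.
Local Open Scope quotient_scope.

(** Suppose that f : B -> S_1 is an approximation of the simple module
    S_1 = Lam e_1 / J e_1. The module B is finite dimensional, say of dimension
    at most d over K; choose n so large that N = m n exceeds d, and let
    x_1, ..., x_N be the chain of top elements of M_n. The equations of the chain
    force x_t to have type e_r, where r is the residue of t.

    Since Lam is split, e_1 determines a character chi : Lam -> K through which
    Lam acts on S_1, and every K-linear functional phi on M_n which vanishes on
    J M_n gives a homomorphism M_n -> S_1 sending v to phi(e_1 v) times the
    generator of S_1. As the x_t are independent modulo J M_n, there is a
    homomorphism g of this kind with g(x_1) the generator of S_1 and g(x_t) = 0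
    for all t > 1 of residue 1. Let h : M_n -> B be a lift of g, so f h = g.

    The N > d elements h(x_t) satisfy a nontrivial relation with coefficients
    c_t in K. Let s be the first index with c_s <> 0. For 1 <= i <= s put
    x'_i = sum c_t x_(t-s+i), where t runs over the indices t >= s congruent to s
    modulo m. These combinations form again a chain,
    p_r(i) x'_i = q_r(i+1) x'_(i+1), and h(x'_s) = 0 because the relation
    multiplied by e_r(s) keeps exactly the terms with t congruent to s. But
    f(h(x'_1)) is c_s times the generator of S_1, so that h(x'_1) is a top
    element of type e_1 of B; the two conditions on objects of the subcategory
    then propagate p_r(i) h(x'_i) <> 0 from i = 1 up to i = s, which is absurd.

    The input from the quiver presentation is primitive_character; the two
    sides of the approximation enter through linear_to_top_of_functional with
    first_coordinate_functional (construction of g), and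
    finitely_generated_dependent with shifted_chain (the contradiction in B). *)

(** * The Jacobson radical and generated ideals *)

(** If x lies outside a maximal left ideal I, then 1 - a x lies in I for some a,
    and a geometric series in the nilpotent a x inverts it. *)
Lemma nil_jacobson (R : nzRingType) (x : R) :
  (forall a, exists n, (a * x) ^+ n = 0) -> jacobson_radical x.
Proof.
move=> nil I [[I0 ID IM] I1 Imax]; apply: contrapT => Ix; apply: I1.
have [I'1|I'1] := pselect (exists2 i, I i & exists a, 1 = i + a * x); last first.
  case: Ix; apply: (Imax (fun y => exists2 i, I i & exists a, y = i + a * x)).
  - split.
    + by exists 0 => //; exists 0; rewrite mul0r addr0.
    + move=> _ _ [i Ii [a ->]] [j Ij [b ->]]; exists (i + j); first exact: ID.
      by exists (a + b); rewrite mulrDl addrACA.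
    + move=> b _ [i Ii [a ->]]; exists (b * i); first exact: IM.
      by exists (b * a); rewrite mulrDr mulrA.
  - by [].
  - by move=> y Iy; exists y => //; exists 0; rewrite mul0r addr0.
  - by exists 0 => //; exists 1; rewrite mul1r add0r.
have [i Ii [a e1]] := I'1; have [n an] := nil a.
have -> : 1 = (\sum_(k < n) (a * x) ^+ k) * i.
  have -> : i = 1 - a * x by rewrite e1 addrK.
  have /commr_sum <- : forall k : 'I_n, true -> GRing.comm (1 - a * x) ((a * x) ^+ k).
    move=> k _; apply/commrX/commr_sym/commrB => //; exact: commr1.
  by apply/oppr_inj; rewrite -mulNr opprB -subrX1 an sub0r.
exact: IM.
Qed.

Lemma generated_ideal_two_sided (R : pzRingType) (S : R -> Prop) :
  two_sided_ideal (generated_ideal S).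
Proof.
split; first split.
- by move=> I [[]].
- move=> x y xS yS I II SI; case: (II) => -[_ ID _] _.
  by apply: ID; [apply: xS | apply: yS].
- by move=> a x xS I II SI; case: (II) => -[_ _ IM] _; apply: IM; apply: xS.
- by move=> a x xS I II SI; case: (II) => _ IM; apply: IM; apply: xS.
Qed.

(** * Coefficients at trivial paths *)

Section PathCoefficients.
Variables (G : quiver) (K : fieldType).
Implicit Types (f g : path_algebra G K) (v : vertex G).

(** A composite of paths is trivial only if both factors are. This makes the
    coefficient at a trivial path a multiplicative function. *)
Lemma coef_trivial_comp v (p q : qpath G) :
  (opath_basis K (path_comp q p))@_(trivial_path v) =
  ((q == trivial_path v) && (p == trivial_path v))%:R.
Proof.
have eqT (r : qpath G) :
    (r == trivial_path v) = (path_source r == v) && (path_arrows r == [::]).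
  by rewrite -val_eqE /path_source /path_arrows; case: (val r).
case: path_compP => [r e1 sr tr ar|ne] /=.
  rewrite mcoeffU !eqT sr ar; congr (_%:R).
  rewrite -size_eq0 size_cat addn_eq0 !size_eq0 -e1 /path_target.
  case: (path_arrows p =P [::]) => [->|_]; last by rewrite !andbF.
  by rewrite /= andbT; case: eqP; rewrite ?andbT ?andbF.
rewrite mcoeff0 !eqT; case: andP => // -[/andP[/eqP sq _] /andP[/eqP sp /eqP ap]].
by case: ne; rewrite /path_target ap /= sp sq.
Qed.

Lemma coef_trivial_mul v f g :
  (f * g)@_(trivial_path v) = f@_(trivial_path v) * g@_(trivial_path v).
Proof.
have expand (h : path_algebra G K) : h@_(trivial_path v) =
    \sum_(p <- msupp h) h@_p * (p == trivial_path v)%:R.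
  rewrite {1}[h]path_basis_sum raddf_sum /=; apply: eq_bigr => p _.
  by rewrite mcoeffZ mcoeffU.
rewrite -[f * g]/(path_mul f g) /path_mul raddf_sum /= (expand f) (expand g).
rewrite big_distrlr /=; apply: eq_bigr => q _; rewrite raddf_sum /=.
apply: eq_bigr => p _; rewrite mcoeffZ coef_trivial_comp.
by rewrite mulrACA -natrM mulnb.
Qed.

Lemma coef_trivial_one v : (1 : path_algebra G K)@_(trivial_path v) = 1.
Proof.
rewrite [1 in LHS](_ : _ = path_one G K) // /path_one raddf_sum /= (bigD1 v) //= mcoeffUU.
rewrite big1 ?addr0 // => w; rewrite mcoeffU -val_eqE /= xpair_eqE eqxx andbT.
by move=> /negPf ->.
Qed.

(** The elements vanishing at all trivial paths form an ideal containing the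
    arrows; conversely a nontrivial path is a multiple of its first arrow. *)
Lemma arrow_idealP f :
  arrow_ideal f <-> forall v, f@_(trivial_path v) = 0.
Proof.
split.
  move=> fA; apply: (fA (fun h => forall v, h@_(trivial_path v) = 0)); last first.
    by move=> _ [a ->] v; rewrite mcoeffU -val_eqE xpair_eqE andbC.
  split; first split.
  - by move=> v; rewrite mcoeff0.
  - by move=> x y x0 y0 v; rewrite mcoeffD x0 y0 addr0.
  - by move=> a x x0 v; rewrite coef_trivial_mul x0 mulr0.
  - by move=> a x x0 v; rewrite coef_trivial_mul x0 mul0r.
move=> f0 I [[I0 ID IM] IMr] Ia.
rewrite [f]path_basis_sum big_seq; apply: big_ind => // p.
rewrite -mcoeff_neq0 => fp.
have -> : f@_p *: path_basis K p = (f@_p)%:A * path_basis K p by rewrite -scalerAl mul1r.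
apply: (IM); case ap : (path_arrows p) => [|a s].
  case/eqP: fp; rewrite -(f0 (path_source p)); congr (f@_ _).
  exact: qpath_eq.
have cp := valP p; move: (cp); rewrite -/(path_source p) -/(path_arrows p) ap /=.
move=> /andP[/eqP sa ca].
have := path_mulU K (@QPath G (target a, s) ca) (arrow_path a).
case: path_compP => [r _ sr _ ar|[]//] e.
have -> : p = r by apply: qpath_eq; rewrite ?sr ?ar ?ap // -sa.
have -> : path_basis K r =
    path_basis K (@QPath G (target a, s) ca) * path_basis K (arrow_path a).
  exact: esym e.
exact: (IM _ _ (Ia _ (ex_intro _ a erefl))).
Qed.

Lemma arrow_ideal_square f : ideal_power (@arrow_ideal G K) 2 f -> arrow_ideal f.
Proof.
have Aid : two_sided_ideal (@arrow_ideal G K) := generated_ideal_two_sided _.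
move=> fP; apply: (fP _ Aid) => _ [x [y [xA _ ->]]].
exact: (proj2 Aid y x xA).
Qed.

Lemma arrow_ideal_power n f :
  arrow_ideal f -> ideal_power (@arrow_ideal G K) n (f ^+ n).
Proof.
move=> fA; elim: n => //= n IH I _; apply.
by exists f, (f ^+ n); split=> //; rewrite exprS.
Qed.

End PathCoefficients.

(** * Characters of a split algebra *)

(** The coefficient at the trivial path of a vertex descends to K Gamma / I since I
    lies in the arrow ideal, and the common kernel of these characters is nilpotent
    since I contains a power of the arrow ideal. The elements eps are the images of
    the trivial paths. *)
Lemma split_characters (K : fieldType) (Lam : falgType K) :
  split_algebra Lam ->
  exists (T : finType) (chi : T -> {lrmorphism Lam -> K^o}) (eps : T -> Lam) (n : nat),
    [/\ forall v w, chi v (eps w) = (v == w)%:R,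
        (0 < n)%N
      & forall x, (forall v, chi v x = 0) -> x ^+ n = 0].
Proof.
case=> G [I [phi [[Iid [n n2 [nI I2]]] phiS kerphi]]].
have [s sK] := choice phiS.
pose chi v (x : Lam) : K^o := (s x)@_(trivial_path v).
have chiE v f : chi v (phi f) = f@_(trivial_path v).
  have : arrow_ideal (s (phi f) - f).
    by apply: arrow_ideal_square; apply: I2; apply/kerphi; rewrite raddfB /= sK subrr.
  by move/arrow_idealP/(_ v)/eqP; rewrite mcoeffB subr_eq0 => /eqP.
have chiL v : linear (chi v).
  move=> a x y; rewrite -[x]sK -[y]sK -linearP !chiE.
  by rewrite mcoeffD mcoeffZ.
have chiM v : monoid_morphism (chi v).
  split; first by rewrite -(rmorph1 phi) chiE coef_trivial_one.
  by move=> x y; rewrite -[x]sK -[y]sK -rmorphM !chiE coef_trivial_mul.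
pose chiR v : {lrmorphism Lam -> K^o} := HB.pack (chi v)
  (GRing.isLinear.Build _ _ _ _ _ (chiL v))
  (GRing.isMonoidMorphism.Build _ _ _ (chiM v)).
exists (vertex G), chiR, (fun w => phi (path_basis K (trivial_path w))), n; split.
- move=> v w; rewrite [LHS]chiE mcoeffU -val_eqE xpair_eqE eqxx andbT.
  by rewrite eq_sym.
- exact: ltnW.
move=> x x0; rewrite -[x]sK -rmorphXn; apply/kerphi; apply: nI; apply: arrow_ideal_power.
by apply/arrow_idealP => v; rewrite -chiE sK; apply: x0.
Qed.

(** Lifting of idempotents modulo a nil ideal. With t = (1 - a)^n, the element 1 - t is
    a multiple of a and 1 - f is a multiple of t, so that f (1 - f) is a multiple of
    a^n (1 - a)^n = (a - a^2)^n. *)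
Lemma idempotent_lift (R : nzRingType) (a : R) (n : nat) :
  (0 < n)%N -> (a - a ^+ 2) ^+ n = 0 ->
  let f := (1 - (1 - a) ^+ n) ^+ n in
  f * f = f /\ exists2 u, f = a * u & f = u * a.
Proof.
move=> n_gt0 an f; set t := (1 - a) ^+ n.
have comma : GRing.comm a (1 - a) by apply: commrB => //; exact: commr1.
have factor b : 1 - (1 - b) ^+ n = b * \sum_(k < n) (1 - b) ^+ k.
  apply: oppr_inj; rewrite opprB -mulNr subrX1; congr (_ * _).
  by rewrite addrAC subrr sub0r.
pose u := \sum_(k < n) (1 - a) ^+ k.
have au : GRing.comm a u by apply: commr_sum => k _; apply: commrX.
have fE : f = (a * u) ^+ n by rewrite /f /t factor.
split; last first.
  exists (u * (a * u) ^+ n.-1); first by rewrite fE mulrA -exprS prednK.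
  have acomm : GRing.comm a (u * (a * u) ^+ n.-1).
    by apply: commrM => //; apply: commrX; apply: commrM.
  by rewrite -acomm fE mulrA -exprS prednK.
suff : f * (1 - f) = 0 by rewrite mulrBr mulr1 => /subr0_eq.
have -> : 1 - f = t * \sum_(k < n) (1 - t) ^+ k.
  by rewrite -factor.
rewrite fE au exprMn_comm; last exact: commr_sym.
rewrite mulrA -[_ * t]mulrA /t -exprMn_comm //.
by rewrite mulrBr mulr1 -expr2 an mulr0 mul0r.
Qed.

(** The character by which the algebra acts on the simple top of its projective
    module generated by e. *)
Definition residue_character (K : fieldType) (Lam : falgType K) (e : Lam)
    (chi : {lrmorphism Lam -> K^o}) : Prop :=
  chi e = 1 /\
  forall x, chi x = 0 -> jacobson_radical (e * x) /\ jacobson_radical (x * e).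

(** A character takes the value 0 or 1 on the idempotent e, and 1 at some vertex v
    as e is not nilpotent. If e had the value 1 at another vertex w too, lifting the
    class of e eps_v e to an idempotent f would split e into f and e - f,
    which are both nonzero by their values at v and w. *)
Lemma primitive_character (K : fieldType) (Lam : falgType K) (e : Lam) :
  split_algebra Lam -> primitive_idempotent e ->
  exists chi, residue_character e chi.
Proof.
move=> /split_characters[T [chi [eps [n [chi_eps n_gt0 chi_nil]]]]] [ee e_neq0 e_prim].
have chi_e v : chi v e = 0 \/ chi v e = 1.
  have : chi v e * (1 - chi v e) = 0.
    by rewrite mulrBr mulr1 -rmorphM ee subrr.
  by move/eqP; rewrite mulf_eq0 subr_eq0 eq_sym => /orP[] /eqP; [left | right].
have [v v1] : exists v, chi v e = 1.
  apply: contrapT => no; case/eqP: e_neq0.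
  have -> : e = e ^+ n.
    by case: (n) n_gt0 => // k _; elim: k => // k IH; rewrite exprS -IH.
  by apply: chi_nil => v; case: (chi_e v) => // v1; case: no; exists v.
have only w : w != v -> chi w e = 0.
  move=> wv; case: (chi_e w) => // w1.
  pose a := e * eps v * e; pose f := (1 - (1 - a) ^+ n) ^+ n.
  have chi_a z : chi z a = (z == v)%:R.
    rewrite !rmorphM /= chi_eps; case: eqVneq => [->|_]; last by rewrite mulr0 mul0r.
    by rewrite v1 !mulr1.
  have [|ff [u fa fa']] := @idempotent_lift Lam a n n_gt0.
    apply: chi_nil => z; rewrite rmorphB rmorphXn /= chi_a.
    by case: (z == v); rewrite ?expr1n ?expr0n subrr.
  rewrite -/f in ff fa fa'.
  have chi_f z : chi z f = (z == v)%:R.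
    rewrite /f rmorphXn rmorphB rmorphXn rmorphB rmorph1 /= chi_a.
    by case: (z == v); rewrite ?subrr ?subr0 ?expr0n ?expr1n ?gtn_eqF // ?subrr ?subr0
      ?expr1n ?expr0n ?gtn_eqF.
  have ea : e * a = a by rewrite /a !mulrA ee.
  have ae : a * e = a by rewrite /a -!mulrA ee.
  have ef : e * f = f by rewrite fa mulrA ea.
  have fe : f * e = f by rewrite fa' -mulrA ae.
  have [||||f0|/subr0_eq ef'] := e_prim f (e - f) ff.
  - by rewrite /idempotent_elt mulrBr !mulrBl ee ef fe ff subrr subr0.
  - by rewrite mulrBr fe ff subrr.
  - by rewrite mulrBl ef ff subrr.
  - by rewrite addrC subrK.
  - by have := chi_f v; rewrite f0 rmorph0 eqxx => /eqP; rewrite eq_sym oner_eq0.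
  - by rewrite ef' chi_f (negPf wv).
exists (chi v); split=> // x x0.
have kill z : chi z e * chi z x = 0.
  by have [->|/only ->] := eqVneq z v; rewrite ?x0 ?mulr0 ?mul0r.
split; apply: nil_jacobson => b; exists n; apply: chi_nil => z;
  rewrite !rmorphM /=.
  by rewrite kill mulr0.
by rewrite [chi z x * _]mulrC kill mulr0.
Qed.

(** * The radical of a module *)

Section RadicalSubmodule.
Variable R : nzRingType.

Lemma jacobson_left_ideal : left_ideal (@jacobson_radical R).
Proof.
split=> [I [[]]|x y xJ yJ I mI|a x xJ I mI] //; have [[_ ID IM] _ _] := mI.
  by apply: ID; [apply: xJ | apply: yJ].
by apply: IM; apply: xJ.
Qed.

Variable M : lmodType R.

Lemma radical0 : radical_submodule (0 : M).
Proof. by exists 0, (fun=> 0), (fun=> 0); split; [case|rewrite big_ord0]. Qed.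

Lemma radicalZ a (x : M) : radical_submodule x -> radical_submodule (a *: x).
Proof.
have [_ _ JM] := jacobson_left_ideal.
case=> n [j [v [jJ ->]]]; exists n, (fun i => a * j i), v; split.
  by move=> i; apply: JM.
by rewrite scaler_sumr; apply: eq_bigr => i _; rewrite scalerA.
Qed.

Lemma radicalD (x y : M) :
  radical_submodule x -> radical_submodule y -> radical_submodule (x + y).
Proof.
case=> n [j [v [jJ ->]]] [n' [j' [v' [jJ' ->]]]].
exists (n + n')%N,
  (fun i => match fintype.split i with inl k => j k | inr k => j' k end),
  (fun i => match fintype.split i with inl k => v k | inr k => v' k end).
split=> [i|]; first by case: fintype.split.
rewrite big_split_ord; congr (_ + _); apply: eq_bigr => i _.
  by rewrite -[lshift n' i]/(unsplit (inl i)) unsplitK.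
by rewrite -[rshift n i]/(unsplit (inr i)) unsplitK.
Qed.

Lemma jacobson_radicalZ j (x : M) : jacobson_radical j -> radical_submodule (j *: x).
Proof.
by move=> jJ; exists 1, (fun=> j), (fun=> x); split=> //; rewrite big_ord1.
Qed.

End RadicalSubmodule.

(** * Linear algebra over K in a module *)

Section ScalarAction.
Variables (K : fieldType) (Lam : falgType K) (M : lmodType Lam).

Lemma scalar_comm (c : K) (a : Lam) (x : M) : a *: (c%:A *: x) = c%:A *: (a *: x).
Proof. by rewrite !scalerA -scalerAr mulr1 -scalerAl mul1r. Qed.

Definition scalar_subspace (S : M -> Prop) : Prop :=
  [/\ S 0, forall x y, S x -> S y -> S (x + y) &
      forall (c : K) x, S x -> S (c%:A *: x)].

Definition scalar_functional (phi : M -> K) : Prop :=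
  forall c x y, phi (c%:A *: x + y) = c * phi x + phi y.

(** A subspace A maximal among those containing S and avoiding x has K x as a
    complement; phi is the coordinate on K x. *)
Lemma separating_functional (S : M -> Prop) (x : M) :
  scalar_subspace S -> ~ S x ->
  exists2 phi, scalar_functional phi & (forall y, S y -> phi y = 0) /\ phi x = 1.
Proof.
move=> Ssub Sx.
pose good (A : set M) := [/\ scalar_subspace A, (S `<=` A)%classic & ~ A x].
(* The union of the empty chain is empty, so the empty set has to be admitted. *)
have [A [+ Amax]] : exists A, (A = set0 \/ good A) /\
    forall B, (A `<` B)%classic -> ~ (B = set0 \/ good B).
  apply: (@Zorn_bigcup _ (fun A => A = set0 \/ good A)) => F FP Ftot.
  have [[X FX [X0 SX Xx]]|no] := pselect (exists2 X, F X & good X).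
    right; split.
    - split.
      + by exists X => //; case: X0.
      + move=> y z [Y FY Yy] [Z FZ Zz].
        have addU W : F W -> W y -> W z -> (\bigcup_(V in F) V)%classic (y + z).
          move=> FW Wy Wz; exists W => //; case: (FP _ FW) => [W0|[[_ WD _] _ _]].
            by move: Wy; rewrite W0.
          exact: WD.
        by have [YZ|ZY] := Ftot _ _ FY FZ; [apply: (addU Z) | apply: (addU Y)];
           auto.
      + move=> c y [Y FY Yy]; exists Y => //.
        case: (FP _ FY) => [Y0|[[_ _ YZ] _ _]]; last exact: YZ.
        by move: Yy; rewrite Y0.
    - by move=> y Sy; exists X => //; apply: SX.
    - move=> [Y FY Yx]; case: (FP _ FY) => [Y0|[_ _]]; last exact.
      by move: Yx; rewrite Y0.
  left; rewrite predeqE => y; split=> // -[Y FY Yy].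
  case: (FP _ FY) => [Y0|gY]; first by move: Yy; rewrite Y0.
  by case: no; exists Y.
have Sgood : good S by split.
have [S0 _ _] := Ssub.
case=> [A0|[[A00 AD AZ] SA Ax]].
  by case: (Amax S); [rewrite A0; split=> // /(_ 0 S0) | right].
have AB y z : A y -> A z -> A (y - z).
  move=> Ay Az; have -> : - z = (- 1)%:A *: z by rewrite !scaleN1r.
  by apply: AD => //; apply: AZ.
have span y : exists c : K, A (y - c%:A *: x).
  apply: contrapT => noc.
  (* By maximality the subspace A + K y contains x. *)
  pose B z := exists2 u, A u & exists c : K, z = u + c%:A *: y.
  have nAy : ~ A y by move=> Ay; apply: noc; exists 0; rewrite !scale0r subr0.
  have AsubB u : A u -> B u by move=> Au; exists u => //; exists 0; rewrite !scale0r addr0.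
  apply: (Amax B).
    split=> // BA; apply/nAy/BA; exists 0 => //; exists 1.
    by rewrite !scale1r add0r.
  right; split.
  - split; first exact: AsubB.
    + move=> _ _ [u Au [c ->]] [w Aw [d ->]]; exists (u + w); first exact: AD.
      by exists (c + d); rewrite !scalerDl addrACA.
    + move=> d _ [u Au [c ->]]; exists (d%:A *: u); first exact: AZ.
      by exists (d * c); rewrite scalerDr scalerA -scalerAl mul1r scalerA.
  - by move=> u /SA; apply: AsubB.
  - move=> [u Au [c xE]].
    have c0 : c != 0.
      by apply/eqP => c0; apply: Ax; rewrite xE c0 !scale0r addr0.
    have cxE : c^-1%:A *: x = c^-1%:A *: u + y.
      by rewrite xE scalerDr scalerA -scalerAl mul1r scalerA mulVf // !scale1r.
    apply: noc; exists c^-1; rewrite cxE opprD addrCA subrr addr0 -[- _]add0r.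
    by apply: AB => //; apply: AZ.
have [phi phiP] := choice span.
have uniq c y : A (y - c%:A *: x) -> phi y = c.
  move=> yc; apply: contrapT => /eqP; rewrite -subr_eq0 => ne.
  apply: Ax; have := AZ (phi y - c)^-1 _ (AB _ _ yc (phiP y)).
  rewrite opprB addrCA addrAC subrr add0r -scalerBl -scalerBl.
  by rewrite scalerA -scalerAl mul1r scalerA mulVf // !scale1r.
exists phi; last split.
- move=> c y z; apply: uniq.
  rewrite !scalerDl opprD addrACA; apply: AD => //.
  by have := AZ c _ (phiP y); rewrite scalerBr scalerA -scalerAl mul1r scalerA.
- by move=> y Sy; apply: uniq; rewrite !scale0r subr0; apply: SA.
- by apply: uniq; rewrite !scale1r subrr.
Qed.

Lemma functionalD phi x y : scalar_functional phi -> phi (x + y) = phi x + phi y.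
Proof. by move=> phiL; have := phiL 1 x y; rewrite !scale1r mul1r. Qed.

Lemma first_coordinate_functional (n : nat) (x : nat -> M) :
  independent_mod_radical n x -> (0 < n)%N ->
  exists2 phi, scalar_functional phi &
    [/\ forall y, radical_submodule y -> phi y = 0, phi (x 1%N) = 1
      & forall i, (1 < i <= n)%N -> phi (x i) = 0].
Proof.
move=> xfree n_gt0.
pose lincomb (c : nat -> K) : M := \sum_(1 <= i < n.+1) (c i)%:A *: x i.
(* The sum of the radical and the span of x 2, ..., x n. *)
pose S y := exists2 c : nat -> K, c 1%N = 0 & radical_submodule (y + lincomb c).
have delta i : (0 < i <= n)%N -> lincomb (fun k => (k == i)%:R) = x i.
  move=> /andP[i0 iN]; rewrite /lincomb (bigD1_seq i) ?iota_uniq ?mem_index_iota ?i0 //=.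
  rewrite eqxx !scale1r big1 ?addr0 // => k /negPf ->.
  by rewrite !scale0r.
have lincombD a c d : lincomb (fun i => a * c i + d i) = a%:A *: lincomb c + lincomb d.
  rewrite /lincomb scaler_sumr -big_split; apply: eq_bigr => i _ /=.
  by rewrite scalerA -scalerAl mul1r scalerA -!scalerDl.
have lincomb0 : lincomb (fun=> 0) = 0.
  by rewrite /lincomb big1 // => i _; rewrite !scale0r.
have radS y : radical_submodule y -> S y.
  by move=> yr; exists (fun=> 0); rewrite ?lincomb0 ?addr0.
have [|Sx|phi phiL [phiS phi1]] := @separating_functional S (x 1%N).
- split.
  + exact/radS/radical0.
  + move=> y z [c c1 yc] [d d1 zd]; exists (fun i => 1 * c i + d i).
      by rewrite c1 d1 mulr0 addr0.
    by rewrite lincombD !scale1r addrACA; apply: radicalD.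
  + move=> a y [c c1 yc]; exists (fun i => a * c i + 0); first by rewrite c1 mulr0 addr0.
    by rewrite lincombD lincomb0 addr0 -scalerDr; apply: radicalZ.
- case: Sx => c c1; rewrite -[x 1%N]delta // -[X in X + _](scale1r (lincomb _)).
  rewrite -[X in X *: _]scale1r -lincombD => /xfree /(_ 1%N).
  by rewrite n_gt0 eqxx c1 addr0 mulr1 => /(_ isT)/eqP; rewrite oner_eq0.
- exists phi => //; split=> // [y /radS /phiS //|i /andP[i1 iN]].
  apply: phiS; exists (fun k => -1 * (k == i)%:R + 0).
    by rewrite eq_sym gtn_eqF // mulr0 addr0.
  rewrite lincombD lincomb0 addr0 delta ?iN ?(ltnW i1) //.
  by rewrite !scaleN1r subrr; apply: radical0.
Qed.

(** The module is a quotient of Lam^k for some k, so that elements more numerous than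
    the dimension of Lam^k have dependent preimages. *)
Lemma finitely_generated_dependent :
  finitely_generated M -> exists d, forall n (y : nat -> M), (d < n)%N ->
  exists2 c : nat -> K, \sum_(1 <= i < n.+1) (c i)%:A *: y i = 0 &
    exists2 i, (1 <= i <= n)%N & c i != 0.
Proof.
case=> k [g gen]; exists (\dim {: {ffun 'I_k -> Lam}}) => n y dn.
have [b bE] := choice gen.
pose X := [tuple [ffun l => b (y i.+1) l] | i < n].
have : ~~ free X.
  apply: contraL dn; rewrite -leqNgt => /eqP Xfree.
  by rewrite -[n](size_tuple X) -Xfree dimvS ?subvf.
move=> /freeP nfree; apply: contrapT => no; apply: nfree => c cX i.
apply: contrapT => /eqP ci; apply: no.
pose c' j := if insub j.-1 is Some l then c l else 0.
have c'E (l : 'I_n) : c' l.+1 = c l by rewrite /c' /= valK.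
exists c'; last by exists i.+1; rewrite ?c'E // ltn_ord.
rewrite big_add1 /= big_mkord.
under eq_bigr => l _ do rewrite c'E (bE (y l.+1)) scaler_sumr.
rewrite exchange_big /= big1 // => j _.
under eq_bigr => l _ do rewrite scalerA.
rewrite -scaler_suml; apply/eqP.
move/ffunP/(_ j): cX; rewrite sum_ffunE ffunE.
under eq_bigr => l _ do rewrite ffunE -tnth_nth tnth_mktuple ffunE.
move=> cX; rewrite (_ : \sum_(l < n) _ = 0) ?scale0r // -[RHS]cX.
by apply: eq_bigr => l _; rewrite -scalerAl mul1r.
Qed.
End ScalarAction.

(** * Homomorphisms to the simple top *)

Section TopGenerator.
Variables (R : nzRingType) (e : R).

Lemma left_span_gen : (e : R^o) \in left_span e.
Proof. by apply/asboolP; exists 1; rewrite mul1r. Qed.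

Definition top_gen : top_module e :=
  \pi_(lmod_quot (rad_span_closed e)) (Sub (e : R^o) left_span_gen : proj_module e).

Lemma top_genZ a : a *: top_gen =
  \pi_(lmod_quot (rad_span_closed e)) (a *: (Sub (e : R^o) left_span_gen : proj_module e)).
Proof. exact: lmod_quot_scale_pi. Qed.

Lemma top_genZ_eq0 a :
  a *: top_gen = 0 <-> exists2 j, jacobson_radical j & a * e = j * e.
Proof.
rewrite top_genZ -[0](raddf0 \pi_(lmod_quot (rad_span_closed e))).
split.
  by move/lmod_quot_eq; rewrite subr0 => /asboolP[j jJ jE]; exists j.
by case=> j jJ jE; apply/lmod_quot_eq; rewrite subr0; apply/asboolP; exists j.
Qed.

Lemma top_gen_span (z : top_module e) : exists a, z = a *: top_gen.
Proof.
have /asboolP[a aE] := valP (repr z : proj_module e).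
exists a; rewrite top_genZ -[LHS]reprK; congr (\pi_(_) _).
exact: val_inj.
Qed.

Lemma top_module_finitely_generated : finitely_generated (top_module e).
Proof.
exists 1, (fun=> top_gen) => z; have [a ->] := top_gen_span z.
by exists (fun=> a); rewrite big_ord1.
Qed.

End TopGenerator.

Section SimpleTop.
Variables (K : fieldType) (Lam : falgType K) (e : Lam).
Variable chi : {lrmorphism Lam -> K^o}.
Hypothesis (ee : e * e = e) (chiP : residue_character e chi).

(** The kernel of a character is a maximal left ideal. *)
Lemma jacobson_character j : jacobson_radical j -> chi j = 0.
Proof.
move=> jJ; apply: (jJ (fun x => chi x = 0)); split.
- split; first exact: rmorph0.
  + by move=> x y /= x0 y0; rewrite rmorphD /= x0 y0 addr0.
  + by move=> a x /= x0; rewrite rmorphM /= x0 mulr0.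
- by rewrite rmorph1 => /eqP; rewrite oner_eq0.
move=> I [_ ID IM] I1 kerI x Ix; apply: contrapT => /eqP x0; apply: I1.
rewrite -[1](subrK ((chi x)^-1%:A * x)); apply: ID; last exact: IM.
apply: kerI; rewrite rmorphB rmorph1 /= -scalerAl mul1r linearZ /=.
by rewrite -[_ *: _]/(_ * _) mulVf ?subrr.
Qed.

Lemma chi_sub x : chi (x - (chi x)%:A) = 0.
Proof. by rewrite rmorphB /= linearZ rmorph1 /= -[_ *: _]/(_ * _) mulr1 subrr. Qed.

Lemma top_gen_neq0 : top_gen e != 0.
Proof.
apply/eqP => gen0; have /(top_genZ_eq0 e 1)[j jJ] : 1 *: top_gen e = 0 by rewrite scale1r.
rewrite mul1r => /(congr1 chi); rewrite rmorphM /= (jacobson_character jJ) mul0r.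
by rewrite (proj1 chiP) => /eqP; rewrite oner_eq0.
Qed.

Lemma top_gen_character a : a *: top_gen e = (chi a)%:A *: top_gen e.
Proof.
apply/eqP; rewrite -subr_eq0 -scalerBl; apply/eqP/top_genZ_eq0.
exists ((a - (chi a)%:A) * e); last by rewrite -mulrA ee.
by have [] := (proj2 chiP) _ (chi_sub a).
Qed.

Lemma linear_to_top_radical (B : lmodType Lam) (f : {linear B -> top_module e}) x :
  radical_submodule x -> f x = 0.
Proof.
case=> n [j [v [jJ ->]]]; rewrite linear_sum big1 // => i _.
rewrite linearZ /=; have [a ->] := top_gen_span (f (v i)).
rewrite top_gen_character scalar_comm (top_gen_character (j i)) (jacobson_character (jJ i)).
by rewrite !scale0r scaler0.
Qed.

(** Homomorphisms from M to the simple top correspond to functionals on e M / e J M;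
    linearity holds since e a and chi(a) e differ by an element of J. *)
Lemma linear_to_top_of_functional (M : lmodType Lam) (phi : M -> K) :
  scalar_functional phi -> (forall x, radical_submodule x -> phi x = 0) ->
  exists f : {linear M -> top_module e}, forall x, f x = (phi (e *: x))%:A *: top_gen e.
Proof.
move=> phiL phirad; pose f x := (phi (e *: x))%:A *: top_gen e.
have fL : linear f.
  move=> a x y; rewrite /f scalar_comm (top_gen_character a).
  have -> : e *: (a *: x + y) = (chi a)%:A *: (e *: x) +
      ((e * (a - (chi a)%:A)) *: x + e *: y).
    rewrite scalerDr addrA; congr (_ + _); rewrite !scalerA -scalerDl mulrBr.
    by rewrite -scalerAr mulr1 -scalerAl mul1r addrC subrK.
  have rad0 : phi ((e * (a - (chi a)%:A)) *: x) = 0.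
    by apply/phirad/jacobson_radicalZ; have [] := (proj2 chiP) _ (chi_sub a).
  rewrite phiL functionalD // rad0.
  by rewrite add0r !scalerDl scalerA -scalerAl mul1r scalerA mulrC.
pose fM : {linear M -> top_module e} :=
  HB.pack f (GRing.isLinear.Build _ _ _ _ _ fL).
by exists fM.
Qed.
End SimpleTop.

(** * Shifted chains *)

Section Residue.
Variable m : nat.

Lemma residue_bounds i : (0 < m)%N -> (1 <= residue m i <= m)%N.
Proof. by move=> m_gt0; rewrite /residue /= ltn_mod. Qed.

Lemma residue_shift s t i : (0 < s <= t)%N -> (0 < i)%N ->
  residue m t = residue m s -> residue m (t - s + i) = residue m i.
Proof.
case: s t i => [|s] [|t] [|i] // st _ [] /eqP e.
rewrite subSS addnS /residue /=; congr _.+1.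
have /dvdnP[k ->] : (m %| t - s)%N by rewrite -eqn_mod_dvd //; apply: st.
by rewrite modnMDl.
Qed.

End Residue.

(** Distinct members of E are orthogonal, so x can only have the type a. *)
Lemma top_element_type (R : nzRingType) (E : seq R) (M : lmodType R) (x : M) (a b : R) :
  complete_primitive_idempotents E -> top_element E x ->
  a \in E -> b = b * a -> 0 <> b *: x -> a *: x = x.
Proof.
case=> _ _ orth _ [a' [a'E _ a'x]] aE bE bx.
have [->|ne] := eqVneq a a'; first exact: a'x.
by case: bx; rewrite bE -{1}a'x scalerA -mulrA (orth _ _ aE a'E ne) mulr0 scale0r.
Qed.

Section ShiftedChain.
Variables (K : fieldType) (Lam : falgType K) (M : lmodType Lam) (m N s : nat).
Variables (c : nat -> K) (x : nat -> M).

(** The terms of the combination of the x t with coefficients c t whose indices are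
    congruent to s modulo m, slid down so that the leading index s becomes i. *)
Definition shifted_comb (i : nat) : M :=
  \sum_(1 <= t < N.+1 | (s <= t)%N && (residue m t == residue m s))
    (c t)%:A *: x (t - s + i)%N.

(** Sliding by a multiple of m preserves residues, hence the equations of the chain. *)
Lemma shifted_chain (p q : nat -> Lam) i : (0 < i < s)%N ->
  (forall k, (1 <= k < N)%N ->
    p (residue m k) *: x k = q (residue m k.+1) *: x k.+1) ->
  p (residue m i) *: shifted_comb i = q (residue m i.+1) *: shifted_comb i.+1.
Proof.
move=> /andP[i0 is_] xchain; rewrite !scaler_sumr big_nat_cond [RHS]big_nat_cond.
apply: eq_bigr => t /andP[/andP[t0 tN] /andP[st /eqP rt]].
have s0 : (0 < s)%N by apply: leq_ltn_trans is_.
rewrite !scalar_comm; congr (_ *: _).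
have st' : (0 < s <= t)%N by rewrite s0.
rewrite -(residue_shift st' i0 rt).
rewrite -(residue_shift st' (ltn0Sn i) rt).
rewrite addnS; apply: xchain; rewrite addn_gt0 i0 orbT /=.
apply: (@leq_trans t) => //; rewrite -[X in (_ <= X)%N](subnK st) -addnS leq_add2l.
exact: is_.
Qed.

End ShiftedChain.
(** * The approximation criterion *)

Theorem mainTheorem3
    (K : fieldType) (Lam : falgType K) (Lam_split : split_algebra Lam)
    (A : module_class Lam) (A_fg : full_subcategory_of_fg A)
    (E : seq Lam) (E_complete : complete_primitive_idempotents E)
    (m : nat) (m_gt0 : (0 < m)%N)
    (e p q : nat -> Lam)
    (e_in_E : forall i, (1 <= i <= m)%N -> e i \in E)
    (e_primitive : forall i, (1 <= i <= m)%N -> primitive_idempotent (e i))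
    (e_orthogonal : forall i j, (1 <= i <= m)%N -> (1 <= j <= m)%N -> i != j ->
       e i * e j = 0)
    (p_rad : forall i, (1 <= i <= m)%N -> jacobson_radical (p i))
    (q_rad : forall i, (1 <= i <= m)%N -> jacobson_radical (q i))
    (p_e : forall i, (1 <= i <= m)%N -> p i = p i * e i)
    (q_e : forall i, (1 <= i <= m)%N -> q i = q i * e i)
    (M : nat -> lmodType Lam)
    (M_in_A : forall n, (1 <= n)%N -> A (M n))
    (M_chain : forall n, (1 <= n)%N ->
       exists x : nat -> M n,
         [/\ forall i, (1 <= i <= m * n)%N -> top_element E (x i),
             independent_mod_radical (m * n) x
           & forall i, (1 <= i < m * n)%N ->
               0 <> p (residue m i) *: x i /\
               p (residue m i) *: x i = q (residue m i.+1) *: x i.+1])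
    (A_start : forall C : lmodType Lam, A C -> forall x : C,
       top_element_of_type E (e 1%N) x -> p 1%N *: x <> 0)
    (A_step : forall C : lmodType Lam, A C -> forall i, (1 <= i)%N ->
       forall y z : C,
         0 <> p (residue m i) *: y ->
         p (residue m i) *: y = q (residue m i.+1) *: z ->
         p (residue m i.+1) *: z <> 0) :
  ~ has_approximation A (fun N => exists2 n, (1 <= n)%N & N = M n)
      (top_module (e 1%N)) /\
  ~ contravariantly_finite A.
Proof.
have [ee _ _] : primitive_idempotent (e 1%N) by apply: e_primitive.
have e1E : e 1%N \in E by apply: e_in_E.
have [chi chiP] := primitive_character Lam_split (e_primitive 1%N m_gt0).
suff noapp : ~ has_approximation A (fun N => exists2 n, (1 <= n)%N & N = M n)
      (top_module (e 1%N)).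
  split=> // fin; apply: noapp.
  have [B [f [AB fapp]]] := fin _ (top_module_finitely_generated (e 1%N)).
  exists B, f; split=> // D g [n n0 DM].
  by apply: fapp; rewrite DM; apply: M_in_A.
case=> B [f [AB fapp]].
have [d dep] := finitely_generated_dependent (A_fg _ AB).
(* The bound N > d gives a dependence in B; N > 1 lets each x t take part in an
   equation of the chain, which determines its type. *)
pose n := d.+2; have n_gt0 : (1 <= n)%N by [].
pose N := (m * n)%N.
have dN : (d.+1 < N)%N by rewrite /N -[X in (X <= _)%N]mul1n leq_mul.
have [x [xtop xfree xchain]] := M_chain n n_gt0.
rewrite -/N in xtop xfree xchain.
have rP i : (1 <= residue m i <= m)%N by apply: residue_bounds.
have xtype t : (1 <= t <= N)%N -> e (residue m t) *: x t = x t.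
  move=> /andP[t0 tN]; have [t1|t1] := leqP t 1.
    have -> : t = 1%N by apply/eqP; rewrite eqn_leq t1.
    have N1 : (1 <= 1 < N)%N by rewrite (leq_trans _ dN).
    apply: (top_element_type E_complete (xtop _ _) (e_in_E _ (rP _)) (p_e _ (rP _))).
      by rewrite leqnn ltnW.
    exact: (proj1 (xchain 1%N N1)).
  have tN' : (1 <= t.-1 < N)%N by case: (t) t1 tN => [|[]].
  apply: (top_element_type E_complete (xtop _ _) (e_in_E _ (rP _)) (q_e _ (rP _))).
    by rewrite t0.
  by have [x0] := xchain _ tN'; rewrite prednK // => <-.
have [phi phiL [phirad phi1 phi0]] := first_coordinate_functional xfree (ltn_trans (ltn0Sn _) dN).
have [g gE] := linear_to_top_of_functional ee chiP phiL phirad.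
have [h hE] := fapp _ g (ex_intro2 _ _ n n_gt0 erefl).
have [c crel [i0 i0N ci0]] := dep N (h \o x) (ltnW dN).
(* The leading index of the relation among the h (x t). *)
have [s /andP[/andP[s0 sN] cs] smin] := ex_minnP (ex_intro
  (fun i => (1 <= i <= N)%N && (c i != 0)) i0 (introT andP (conj i0N ci0))).
pose x' := shifted_comb m N s c x.
have e_kill k t : (1 <= k <= m)%N -> (1 <= t <= N)%N -> residue m t != k ->
    e k *: x t = 0.
  by move=> kP tP ne; rewrite -xtype // scalerA e_orthogonal ?scale0r // eq_sym.
have r1 : residue m 1 = 1%N by rewrite /residue mod0n.
have tP t : (s <= t <= N)%N -> (1 <= t - s + 1 <= N)%N.
  move=> /andP[st tN]; rewrite addn1; apply: leq_trans tN.
  by rewrite ltn_subrL s0 (leq_trans s0 st).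
have r1t t : (s <= t)%N -> residue m t = residue m s -> residue m (t - s + 1) = 1%N.
  by move=> st rt; rewrite (@residue_shift m s) ?s0.
have xtype1 t : (1 <= t <= N)%N -> residue m t = 1%N -> e 1%N *: x t = x t.
  by move=> tN rt; rewrite -[in e _]rt xtype.
have e_x'1 : e 1%N *: x' 1%N = x' 1%N.
  rewrite /x' /shifted_comb scaler_sumr big_nat_cond [RHS]big_nat_cond.
  apply: eq_bigr => t /andP[/andP[t0 tN] /andP[st /eqP rt]].
  by rewrite scalar_comm xtype1 ?r1t ?tP // st.
have gx'1 : g (x' 1%N) = (c s)%:A *: top_gen (e 1%N).
  rewrite /x' /shifted_comb linear_sum big_mkcond.
  rewrite (bigD1_seq s) ?iota_uniq ?mem_index_iota ?s0 //= leqnn eqxx /=.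
  rewrite big1_seq ?addr0; last first.
    move=> t /andP[ts]; rewrite mem_index_iota => /andP[t0 tN].
    case: ifP => // /andP[st /eqP rt].
    have tsN : (1 <= t - s + 1 <= N)%N by apply: tP; rewrite st.
    rewrite linearZ /= gE xtype1 ?r1t // phi0 ?scale0r ?scaler0 //.
    by case/andP: tsN => _ ->; rewrite andbT addn1 ltnS subn_gt0 ltn_neqAle eq_sym ts.
  rewrite subnn linearZ /= gE xtype1 ?phi1 ?scale1r //.
  by rewrite (leq_trans s0 sN).
have hx's : h (x' s) = 0.
  (* Multiplying the relation by this idempotent selects the indices congruent
     to s; those below s have coefficient 0. *)
  transitivity (e (residue m s) *: \sum_(1 <= i < N.+1) (c i)%:A *: h (x i)); last first.
    by rewrite [X in _ *: X]crel scaler0.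
  rewrite /x' /shifted_comb linear_sum scaler_sumr big_mkcond big_nat_cond [RHS]big_nat_cond.
  apply: eq_bigr => t /andP[/andP[t0 tN] _]; rewrite ltnS in tN.
  rewrite scalar_comm -linearZ /=; case: leqP => [st|ts] /=; last first.
    have [-> |ct] := eqVneq (c t) 0; first by rewrite !scale0r.
    by have := smin t; rewrite t0 tN ct leqNgt ts => /(_ isT).
  case: eqVneq => [rt|ne].
    by rewrite linearZ subnK // -rt xtype ?t0.
  by rewrite e_kill ?t0 // linear0 scaler0.
have x'chain i : (1 <= i < s)%N ->
    p (residue m i) *: h (x' i) = q (residue m i.+1) *: h (x' i.+1).
  move=> iP; rewrite -!linearZ; congr (h _).
  by apply: shifted_chain => // k kN; apply: (proj2 (xchain k kN)).
have hx'top : top_element_of_type E (e 1%N) (h (x' 1%N)).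
  split=> //; last by rewrite -linearZ /= e_x'1.
  move=> /(linear_to_top_radical ee chiP f); rewrite hE gx'1.
  move/(congr1 ( *:%R (c s)^-1%:A)); rewrite scaler0 scalerA -scalerAl mul1r scalerA.
  by rewrite mulVf // !scale1r => gen0; case/eqP: (top_gen_neq0 chiP).
have nonzero i : (1 <= i <= s)%N -> p (residue m i) *: h (x' i) <> 0.
  elim: i => // -[_ _|i IH /andP[_ iS]].
    by rewrite r1; apply: A_start.
  have iP : (1 <= i.+1 < s)%N by [].
  apply: (A_step B AB i.+1) (x'chain _ iP) => //.
  by apply/nesym/IH/ltnW.
by apply: (nonzero s); rewrite ?s0 ?leqnn // hx's scaler0.
Qed.
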